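(* Let $A$ be an associative ring with $1$, let $\rho=\mathrm{id}_A$, and suppose that $\alpha\in A$ is a unit and $\beta\in A$ is an element with $\alpha\beta\alpha^{-1}\neq\beta$. Then the Witt vector $$\bar y=\alpha(1+\beta z)\alpha^{-1}(1+\beta z)^{-1}\in W(A,\rho)$$ does not belong to the commutator subgroup $[W(A,\rho),W(A,\rho)]$, but its class in $W(A,\rho)^{ab}$ lies in the kernel of the natural surjection $J:W(A,\rho)^{ab}\to W_1(A,\rho)$. Hence in general (already in the untwisted case $\rho=\mathrm{id}$) $J$ is not an isomorphism.
   Context: For a ring automorphism $\rho$ of $A$, $A_\rho[[z]]$ is the ring of power series $\sum_{j\ge0}a_jz^j$, $a_j\in A$, with $az=z\rho(a)$ (so for $\rho=\mathrm{id}$, $z$ is central). $W(A,\rho)=1+zA_\rho[[z]]$ is the multiplicative group of Witt vectors, a subgroup of the group of units of $A_\rho[[z]]$, and $W(A,\rho)^{ab}=W(A,\rho)/[W(A,\rho),W(A,\rho)]$. $W_1(A,\rho)$ is the subgroup of the Whitehead group $K_1(A_\rho[[z]])$ consisting of the torsions $\tau(w)$ (classes of the $1\times 1$ invertible matrices $(w)$) of the elements $w\in W(A,\rho)$. The map $J$ is induced by $w\mapsto\tau(w)$. *)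

(* Defs.v *)
From HB Require Import structures.
From mathcomp Require Import all_boot all_order all_algebra.
From mathcomp Require Import boolp classical_sets functions cardinality fsbigop.

Set Implicit Arguments.
Unset Strict Implicit.
Unset Printing Implicit Defensive.

Import GRing.Theory.
Local Open Scope ring_scope.
Local Open Scope quotient_scope.

(* The group of (two-sided) units of an arbitrary ring; MathComp's
   unitRingType only covers rings with a decidable notion of unit. *)

Section UnitGroup.
Variable R : pzRingType.

Definition invertible : {pred R} :=
  fun x => `[< exists y, x * y = 1 /\ y * x = 1 >].

Record unitGroup := UnitGroup { unit_val : R; _ : unit_val \in invertible }.

HB.instance Definition _ := [isSub for unit_val].
HB.instance Definition _ := [Choice of unitGroup by <:].


Implicit Types u v : unitGroup.

Lemma invertible_wit (x : R) : invertible x -> {y | x * y = 1 /\ y * x = 1}.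
Proof. by move/asboolP/cid. Qed.

Lemma mk_invertible (x y : R) : x * y = 1 -> y * x = 1 -> invertible x.
Proof. by move=> xy yx; apply/asboolP; exists y. Qed.

Definition mk_unit (x y : R) (xy : x * y = 1) (yx : y * x = 1) : unitGroup :=
  Sub x (mk_invertible xy yx).

Definition unit_one : unitGroup := mk_unit (mulr1 1) (mulr1 1).

Definition unit_inv_val u : R := sval (invertible_wit (valP u)).

Lemma unit_divr u : val u * unit_inv_val u = 1.
Proof. by rewrite /unit_inv_val; case: invertible_wit => ? []. Qed.

Lemma unit_divl u : unit_inv_val u * val u = 1.
Proof. by rewrite /unit_inv_val; case: invertible_wit => ? []. Qed.

Definition unit_inv u : unitGroup := mk_unit (unit_divl u) (unit_divr u).

Lemma unit_mulV u v :
  val u * val v * (unit_inv_val v * unit_inv_val u) = 1.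
Proof. by rewrite mulrA -(mulrA (val u)) unit_divr mulr1 unit_divr. Qed.

Lemma unit_Vmul u v :
  unit_inv_val v * unit_inv_val u * (val u * val v) = 1.
Proof.
by rewrite mulrA -(mulrA (unit_inv_val v)) unit_divl mulr1 unit_divl.
Qed.

Definition unit_mul u v : unitGroup := mk_unit (unit_mulV u v) (unit_Vmul u v).

Lemma unit_mulA : associative unit_mul.
Proof. by move=> u v w; apply: val_inj; rewrite /= mulrA. Qed.
Lemma unit_mul1g : left_id unit_one unit_mul.
Proof. by move=> u; apply: val_inj; rewrite /= mul1r. Qed.
Lemma unit_mulg1 : right_id unit_one unit_mul.
Proof. by move=> u; apply: val_inj; rewrite /= mulr1. Qed.
Lemma unit_mulVg : left_inverse unit_one unit_inv unit_mul.
Proof. by move=> u; apply: val_inj; rewrite /= unit_divl. Qed.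
Lemma unit_mulgV : right_inverse unit_one unit_inv unit_mul.
Proof. by move=> u; apply: val_inj; rewrite /= unit_divr. Qed.

HB.instance Definition _ := isGroup.Build unitGroup
  unit_mulA unit_mul1g unit_mulg1 unit_mulVg unit_mulgV.

Lemma val_unitM u v : val (u * v)%g = val u * val v. Proof. by []. Qed.
Lemma val_unit1 : val (1%g : unitGroup) = 1. Proof. by []. Qed.
Lemma val_unitV u : val u * val (u^-1)%g = 1. Proof. exact: unit_divr. Qed.
Lemma val_unitVl u : val (u^-1)%g * val u = 1. Proof. exact: unit_divl. Qed.

End UnitGroup.

Section Abelianization.
Variable G : groupType.

(* [G, G]: the intersection of all subgroups containing the commutators;
   ab below is the quotient G / [G, G]. *)
Definition commSubgroup : {pred G} := fun x =>
  `[< forall H : {pred G}, group_closed H ->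
        (forall a b : G, [~ a, b]%g \in H) -> x \in H >].

Lemma commSubgroupP x : reflect
  (forall H : {pred G}, group_closed H ->
     (forall a b : G, [~ a, b]%g \in H) -> x \in H) (x \in commSubgroup).
Proof. exact: asboolP. Qed.

Lemma commSubgroup_closed : group_closed commSubgroup.
Proof.
split; first by apply/commSubgroupP => H [].
move=> x y /commSubgroupP hx /commSubgroupP hy; apply/commSubgroupP => H cH hH.
by case: (cH) => _; apply; [exact: hx | exact: hy].
Qed.

Lemma commSubgroupR a b : [~ a, b]%g \in commSubgroup.
Proof. by apply/commSubgroupP => H _; apply. Qed.

Lemma commSubgroupM :
  {in commSubgroup &, forall x y, (x * y)%g \in commSubgroup}.
Proof. exact: (group_closedM commSubgroup_closed). Qed.

Lemma commSubgroupV : {in commSubgroup, forall x, (x^-1)%g \in commSubgroup}.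
Proof. exact: (group_closedV commSubgroup_closed). Qed.

Lemma commSubgroupJ x y : x \in commSubgroup -> (x ^ y)%g \in commSubgroup.
Proof.
move=> hx; have -> : (x ^ y = x * [~ x, y])%g by rewrite commgEl mulVKg.
exact: commSubgroupM (commSubgroupR _ _).
Qed.

Definition ab_rel : rel G := fun x y => (x^-1 * y)%g \in commSubgroup.

Lemma ab_rel_refl : reflexive ab_rel.
Proof. by move=> x; rewrite /ab_rel mulVg; case: commSubgroup_closed. Qed.

Lemma ab_rel_sym : symmetric ab_rel.
Proof.
have h x y : ab_rel x y -> ab_rel y x.
  by move/commSubgroupV; rewrite invgM invgK.
by move=> x y; apply/idP/idP; exact: h.
Qed.

Lemma ab_rel_trans : transitive ab_rel.
Proof.
by move=> y x z xy /(commSubgroupM xy); rewrite mulgA mulgK.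
Qed.

Canonical ab_equiv := EquivRel ab_rel ab_rel_refl ab_rel_sym ab_rel_trans.

Definition ab := {eq_quot ab_equiv}.

HB.instance Definition _ := Choice.on ab.
HB.instance Definition _ := EqQuotient.on ab.

Definition ab_class (x : G) : ab := \pi_ab x.

Lemma ab_classP x y :
  reflect (ab_class x = ab_class y) ((x^-1 * y)%g \in commSubgroup).
Proof. exact: (iffP (eqmodP ab_equiv x y)). Qed.

Lemma ab_class_repr (a : ab) : ab_class (repr a) = a.
Proof. exact: reprK. Qed.

Definition ab_mul (a b : ab) : ab := ab_class (repr a * repr b)%g.
Definition ab_inv (a : ab) : ab := ab_class (repr a)^-1%g.

Lemma ab_mulE x y : ab_mul (ab_class x) (ab_class y) = ab_class (x * y)%g.
Proof.
apply/ab_classP; rewrite invgM.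
have /ab_classP hx := ab_class_repr (ab_class x).
have /ab_classP hy := ab_class_repr (ab_class y).
set x' := repr _ in hx *; set y' := repr _ in hy *.
have -> : (y'^-1 * x'^-1 * (x * y) = (x'^-1 * x) ^ y' * (y'^-1 * y))%g.
  by rewrite /conjg !mulgA mulgK.
exact: commSubgroupM (commSubgroupJ _ hx) hy.
Qed.

Lemma ab_invE x : ab_inv (ab_class x) = ab_class x^-1%g.
Proof.
apply/ab_classP; rewrite invgK.
have /ab_classP hx := ab_class_repr (ab_class x).
set x' := repr _ in hx *.
have -> : (x' * x^-1 = ((x'^-1 * x)^-1) ^ x'^-1)%g.
  by rewrite /conjg !invgM !invgK !mulgA mulgK.
exact/commSubgroupJ/commSubgroupV.
Qed.

Lemma ab_ind (P : ab -> Prop) : (forall x, P (ab_class x)) -> forall a, P a.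
Proof. by move=> h a; rewrite -(ab_class_repr a). Qed.

Lemma ab_mulA : associative ab_mul.
Proof.
by elim/ab_ind=> x; elim/ab_ind=> y; elim/ab_ind=> z; rewrite !ab_mulE mulgA.
Qed.
Lemma ab_mul1g : left_id (ab_class 1%g) ab_mul.
Proof. by elim/ab_ind=> x; rewrite ab_mulE mul1g. Qed.
Lemma ab_mulg1 : right_id (ab_class 1%g) ab_mul.
Proof. by elim/ab_ind=> x; rewrite ab_mulE mulg1. Qed.
Lemma ab_mulVg : left_inverse (ab_class 1%g) ab_inv ab_mul.
Proof. by elim/ab_ind=> x; rewrite ab_invE ab_mulE mulVg. Qed.
Lemma ab_mulgV : right_inverse (ab_class 1%g) ab_inv ab_mul.
Proof. by elim/ab_ind=> x; rewrite ab_invE ab_mulE mulgV. Qed.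

HB.instance Definition _ := isGroup.Build ab
  ab_mulA ab_mul1g ab_mulg1 ab_mulVg ab_mulgV.

Lemma ab_classM : {morph ab_class : x y / (x * y)%g}.
Proof. by move=> x y; rewrite -ab_mulE. Qed.
HB.instance Definition _ := isUMagmaMorphism.Build G ab ab_class
  (conj (erefl _) ab_classM).

Lemma ab_mulC : @commutative ab ab (fun a b => a * b)%g.
Proof.
elim/ab_ind=> x; elim/ab_ind=> y; rewrite -!ab_classM.
by apply/ab_classP; rewrite invgM -mulgA; exact: commSubgroupR.
Qed.

End Abelianization.
Arguments commSubgroup : clear implicits.

(* GL(R) = union of the GL_n(R), as infinite matrices: stab A is A in the
   upper left n x n corner and the identity elsewhere. *)

Section StableGL.
Variable R : pzRingType.

Definition stab n (A : 'M[R]_n) : nat -> nat -> R := fun i j =>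
  if (insub i, insub j) is (Some i', Some j') then A i' j' else (i == j)%:R.

Definition inf_mulmx (M N : nat -> nat -> R) : nat -> nat -> R :=
  fun i j => \sum_(k \in [set: nat]) M i k * N k j.

Lemma stab_ord n (A : 'M[R]_n) (i j : 'I_n) : stab A i j = A i j.
Proof. by rewrite /stab !valK. Qed.

Lemma stab_outl n (A : 'M[R]_n) i j : (n <= i)%N -> stab A i j = (i == j)%:R.
Proof. by move=> ni; rewrite /stab insubF // ltnNge ni. Qed.

Lemma stab_outr n (A : 'M[R]_n) i j : (n <= j)%N -> stab A i j = (i == j)%:R.
Proof.
by move=> nj; rewrite /stab; case: insub => // i'; rewrite insubF // ltnNge nj.
Qed.

Lemma stab1 n : stab (1 : 'M[R]_n) = fun i j => (i == j)%:R.
Proof.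
apply/funext => i; apply/funext => j.
case: (ltnP i n) => hi; last exact: stab_outl.
case: (ltnP j n) => hj; last exact: stab_outr.
by rewrite (stab_ord _ (Ordinal hi) (Ordinal hj)) mxE.
Qed.

Lemma inf_mulmx_fin n (M N : nat -> nat -> R) i j :
  (forall k, (n <= k)%N -> M i k * N k j = 0) ->
  inf_mulmx M N i j = \sum_(k < n) M i k * N k j.
Proof.
move=> h; rewrite /inf_mulmx (fsbig_ord _ n (fun k => M i k * N k j)).
apply/esym/fsbig_widen => //= k.
by move=> [_ /negP]; rewrite -leqNgt => /h.
Qed.

Lemma stabM n (A B : 'M[R]_n) : inf_mulmx (stab A) (stab B) = stab (A * B).
Proof.
apply/funext => i; apply/funext => j.
case: (ltnP i n) => hi; last first.
  rewrite stab_outl // (@inf_mulmx_fin (i.+1)); last first.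
    by move=> k ik; rewrite stab_outl // (ltn_eqF ik) mul0r.
  rewrite big_ord_recr /= stab_outl // eqxx mul1r stab_outl // big1 ?add0r //.
  by move=> k _; rewrite stab_outl // (gtn_eqF (ltn_ord k)) mul0r.
rewrite (@inf_mulmx_fin n); last first.
  move=> k nk; rewrite stab_outr // (ltn_eqF (leq_trans hi nk)) mul0r //.
case: (ltnP j n) => hj; last first.
  rewrite stab_outr // (ltn_eqF (leq_trans hi hj)) big1 // => k _.
  rewrite [stab B _ _]stab_outr // (ltn_eqF (leq_trans (ltn_ord k) hj)).
  by rewrite mulr0.
rewrite (stab_ord _ (Ordinal hi) (Ordinal hj)) mxE; apply: eq_bigr => k _.
by rewrite (stab_ord A (Ordinal hi)) (stab_ord B _ (Ordinal hj)).
Qed.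

Lemma stab_block n m (A : 'M[R]_n) :
  stab (block_mx A 0 0 1%:M : 'M_(n + m)) = stab A.
Proof.
apply/funext => i; apply/funext => j.
case: (ltnP i (n + m)) => hi; last first.
  by rewrite !stab_outl // (leq_trans (leq_addr m n)).
case: (ltnP j (n + m)) => hj; last first.
  by rewrite !stab_outr // (leq_trans (leq_addr m n)).
rewrite (stab_ord _ (Ordinal hi) (Ordinal hj)).
case: (split_ordP (Ordinal hi)) => i' ei;
  case: (split_ordP (Ordinal hj)) => j' ej;
  rewrite ei ej; move: (congr1 val ei) (congr1 val ej) => /= -> ->.
- by rewrite block_mxEul stab_ord.
- by rewrite block_mxEur mxE stab_outr ?leq_addr // ltn_eqF // ltn_addr.
- by rewrite block_mxEdl mxE stab_outl ?leq_addr // gtn_eqF // ltn_addr.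
- by rewrite block_mxEdr mxE stab_outl ?leq_addr // eqn_add2l.
Qed.

Definition stableGL_pred : {pred nat -> nat -> R} := fun M =>
  `[< exists n (A : unitGroup 'M[R]_n), M = stab (val A) >].

Record stableGL := StableGL {
  stableGL_val : nat -> nat -> R;
  _ : stableGL_val \in stableGL_pred
}.

HB.instance Definition _ := [isSub for stableGL_val].
HB.instance Definition _ := [Choice of stableGL by <:].


Implicit Types g h : stableGL.

Lemma stab_inGL n (A : unitGroup 'M[R]_n) : stableGL_pred (stab (val A)).
Proof. by apply/asboolP; exists n, A. Qed.

Definition GLn_stab n (A : unitGroup 'M[R]_n) : stableGL :=
  Sub (stab (val A)) (stab_inGL A).

Lemma GLn_stab_widen n N (A : unitGroup 'M[R]_n) : (n <= N)%N ->
  exists B : unitGroup 'M[R]_N, GLn_stab A = GLn_stab B.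
Proof.
move=> /subnKC <-; move: (N - n)%N => {N} m.
have blk (P Q : 'M[R]_n) : P * Q = 1 ->
  block_mx P 0 0 1%:M * block_mx Q 0 0 1%:M = 1 :> 'M[R]_(n + m).
  move=> PQ; rewrite -[LHS]/(_ *m _) mulmx_block !mulmx0 !mul0mx !mulmx1.
  by rewrite !add0r !addr0 [P *m Q]PQ -scalar_mx_block.
exists (mk_unit (blk _ _ (val_unitV A)) (blk _ _ (val_unitVl A))).
by apply: val_inj; rewrite /= stab_block.
Qed.

Lemma stableGLP g : exists n, forall N, (n <= N)%N ->
  exists A : unitGroup 'M[R]_N, g = GLn_stab A.
Proof.
case: g => M hM; case/asboolP: (hM) => n [A eM].
exists n => N /(GLn_stab_widen A).
by case=> B eB; exists B; rewrite -eB; apply: val_inj.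
Qed.

Lemma stableGL_mul_subproof g h : stableGL_pred (inf_mulmx (val g) (val h)).
Proof.
have [n hn] := stableGLP g; have [m hm] := stableGLP h.
have [A ->] := hn _ (leq_maxl n m); have [B ->] := hm _ (leq_maxr n m).
by rewrite stabM; exact: (stab_inGL (A * B)%g).
Qed.

Definition stableGL_mul g h : stableGL := Sub _ (stableGL_mul_subproof g h).
Definition stableGL_one : stableGL := @GLn_stab 0 1%g.

Lemma GLn_stabM n (A B : unitGroup 'M[R]_n) :
  GLn_stab (A * B)%g = stableGL_mul (GLn_stab A) (GLn_stab B).
Proof. by apply: val_inj; rewrite /= stabM. Qed.

Lemma GLn_stab1 n : @GLn_stab n 1%g = stableGL_one.
Proof. by apply: val_inj; rewrite /= !stab1. Qed.

Lemma stableGL_inv_subproof g :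
  exists h, stableGL_mul h g = stableGL_one /\ stableGL_mul g h = stableGL_one.
Proof.
have [n /(_ n (leqnn n))[A ->]] := stableGLP g.
by exists (GLn_stab A^-1%g); rewrite -!GLn_stabM mulVg mulgV GLn_stab1.
Qed.

Definition stableGL_inv g : stableGL := sval (cid (stableGL_inv_subproof g)).

Lemma stableGL_mulA : associative stableGL_mul.
Proof.
move=> f g h; have [n hn] := stableGLP f; have [m hm] := stableGLP g.
have [p hp] := stableGLP h; pose N := maxn n (maxn m p).
have [A ->] := hn N (leq_maxl _ _).
have [B ->] := hm N (leq_trans (leq_maxl _ _) (leq_maxr _ _)).
have [C ->] := hp N (leq_trans (leq_maxr _ _) (leq_maxr _ _)).
by rewrite -!GLn_stabM mulgA.
Qed.
Lemma stableGL_mul1g : left_id stableGL_one stableGL_mul.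
Proof.
move=> g; have [n /(_ n (leqnn n))[A ->]] := stableGLP g.
by rewrite -(GLn_stab1 n) -GLn_stabM mul1g.
Qed.
Lemma stableGL_mulg1 : right_id stableGL_one stableGL_mul.
Proof.
move=> g; have [n /(_ n (leqnn n))[A ->]] := stableGLP g.
by rewrite -(GLn_stab1 n) -GLn_stabM mulg1.
Qed.
Lemma stableGL_mulVg : left_inverse stableGL_one stableGL_inv stableGL_mul.
Proof. by move=> g; rewrite /stableGL_inv; case: cid => ? []. Qed.
Lemma stableGL_mulgV : right_inverse stableGL_one stableGL_inv stableGL_mul.
Proof. by move=> g; rewrite /stableGL_inv; case: cid => ? []. Qed.

HB.instance Definition _ := isGroup.Build stableGL stableGL_mulA
  stableGL_mul1g stableGL_mulg1 stableGL_mulVg stableGL_mulgV.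

HB.instance Definition _ n :=
  isUMagmaMorphism.Build (unitGroup 'M[R]_n) stableGL (@GLn_stab n)
    (conj (GLn_stab1 n) (@GLn_stabM n)).

End StableGL.

Definition K1 (R : pzRingType) := ab (stableGL R).

HB.instance Definition _ R := Group.on (K1 R).

Section Torsion.
Variable R : pzRingType.

Lemma scalar_unitV (u : unitGroup R) :
  (val u)%:M * (val u^-1%g)%:M = 1 :> 'M[R]_1.
Proof. by rewrite -[LHS]/(_ *m _) -scalar_mxM val_unitV. Qed.

Lemma scalar_unitVl (u : unitGroup R) :
  (val u^-1%g)%:M * (val u)%:M = 1 :> 'M[R]_1.
Proof. by rewrite -[LHS]/(_ *m _) -scalar_mxM val_unitVl. Qed.

Definition unit_mx11 (u : unitGroup R) : unitGroup 'M[R]_1 :=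
  mk_unit (scalar_unitV u) (scalar_unitVl u).

Definition torsion (u : unitGroup R) : K1 R :=
  ab_class (GLn_stab (unit_mx11 u)).

Lemma torsion_morphism : monoid.monoid_morphism torsion.
Proof.
have h1 : unit_mx11 1%g = 1%g by apply: val_inj.
have hM u v : unit_mx11 (u * v)%g = (unit_mx11 u * unit_mx11 v)%g.
  by apply: val_inj; rewrite /= scalar_mxM.
by split=> [|u v]; rewrite /torsion ?h1 ?hM ?gmulf1 ?gmulfM.
Qed.

HB.instance Definition _ :=
  isUMagmaMorphism.Build (unitGroup R) (K1 R) torsion torsion_morphism.

End Torsion.

Record ringAut (A : pzRingType) := RingAut {
  aut : {rmorphism A -> A};
  autV : {rmorphism A -> A};
  autK : cancel aut autV;
  autVK : cancel autV aut
}.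

Definition idAut (A : pzRingType) : ringAut A :=
  @RingAut A idfun idfun (fun=> erefl) (fun=> erefl).

(* A_rho[[z]]: the series f stands for \sum_j (f j) z^j with a z = z rho(a),
   i.e. z^i b = rho^-i(b) z^i. *)

Record tseries (A : pzRingType) (rho : ringAut A) :=
  TSeries { scoef :> nat -> A }.

HB.instance Definition _ A rho := gen_eqMixin (@tseries A rho).
HB.instance Definition _ A rho := gen_choiceMixin (@tseries A rho).

Section TwistedSeries.
Variables (A : pzRingType) (rho : ringAut A).
Local Notation series := (tseries rho).
Implicit Types (f g h : series) (a b : A) (i j n : nat).

Definition twist i : A -> A := iter i (autV rho).

Lemma twist0 a : twist 0 a = a. Proof. by []. Qed.
Lemma twistD i j a : twist (i + j) a = twist i (twist j a).
Proof. exact: iterD. Qed.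
Lemma twist_monoid i : GRing.monoid_morphism (twist i).
Proof.
by split=> [|a b]; elim: i => //= i ->; rewrite ?rmorph1 ?rmorphM.
Qed.
Lemma twist_additive i : GRing.nmod_morphism (twist i).
Proof.
by split=> [|a b]; elim: i => //= i ->; rewrite ?raddf0 ?raddfD.
Qed.
HB.instance Definition _ i :=
  GRing.isNmodMorphism.Build A A (twist i) (twist_additive i).
HB.instance Definition _ i :=
  GRing.isMonoidMorphism.Build A A (twist i) (twist_monoid i).

Lemma seriesP f g : f =1 g -> f = g.
Proof. by case: f g => [f] [g] /= /funext ->. Qed.

Definition sconst a : series := TSeries rho (fun n => if n is 0 then a else 0).
Definition sz : series := TSeries rho (fun n => (n == 1)%:R).

Definition szero : series := TSeries rho (fun=> 0).
Definition sopp f : series := TSeries rho (fun n => - f n).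
Definition sadd f g : series := TSeries rho (fun n => f n + g n).
Definition smul f g : series :=
  TSeries rho (fun n => \sum_(i < n.+1) f i * twist i (g (n - i)%N)).

Lemma saddA : associative sadd.
Proof. by move=> f g h; apply: seriesP=> n; exact: addrA. Qed.
Lemma saddC : commutative sadd.
Proof. by move=> f g; apply: seriesP=> n; exact: addrC. Qed.
Lemma sadd0 : left_id szero sadd.
Proof. by move=> f; apply: seriesP=> n; exact: add0r. Qed.
Lemma saddN : left_inverse szero sopp sadd.
Proof. by move=> f; apply: seriesP=> n; exact: addNr. Qed.

Lemma smulA : associative smul.
Proof.
move=> f g h; apply: seriesP=> n.
pose c i k := f i * twist i (g (k - i)%N) * twist k (h (n - k)%N).
transitivity (\sum_(i < n.+1) \sum_(k < n.+1 | (i <= k)%N) c i k).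
  apply: eq_bigr => i _; rewrite /smul raddf_sum mulr_sumr /=.
  have le_i : (i <= n)%N by rewrite -ltnS.
  rewrite -(big_mkord predT (fun j => f i *
     twist i (g j * twist j (h (n - i - j)%N)))).
  rewrite -(big_mkord (fun k => (i <= k)%N) (fun k => c i k)).
  rewrite [RHS](big_cat_nat _ (n := i)) ?leqW //= [X in X + _]big1_seq ?add0r.
    rewrite [RHS](_ : _ = \sum_(0 + i <= k < n.+1 | (i <= k)%N) c i k) //.
    rewrite big_addn subSn // [RHS](eq_bigl predT) => [|j]; last first.
      by rewrite leq_addl.
    apply: eq_bigr => j _.
    by rewrite /c addnK rmorphM mulrA addnC twistD subnDA.
  by move=> k /andP[ik]; rewrite mem_index_iota => /andP[_]; rewrite ltnNge ik.
rewrite (exchange_big_dep predT) //=; apply: eq_bigr => k _.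
rewrite /smul mulr_suml.
have le_k : (k < n.+1)%N by [].
rewrite (big_ord_widen_cond n.+1 predT
  (fun i => f i * twist i (g (k - i)%N) * twist k (h (n - k)%N))) //=.
Qed.

Lemma smul1 : left_id (sconst 1) smul.
Proof.
move=> f; apply: seriesP=> n; rewrite /= big_ord_recl /= mul1r subn0.
by rewrite big1 ?addr0 // => i _; rewrite mul0r.
Qed.
Lemma smulr1 : right_id (sconst 1) smul.
Proof.
move=> f; apply: seriesP=> n; rewrite /= big_ord_recr /= subnn rmorph1 mulr1.
rewrite big1 ?add0r // => i _; rewrite -(subnSK (ltn_ord i)) /=.
by rewrite rmorph0 mulr0.
Qed.
Lemma smulDl : left_distributive smul sadd.
Proof.
move=> f g h; apply: seriesP=> n; rewrite /= -big_split /=.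
by apply: eq_bigr => i _; rewrite mulrDl.
Qed.
Lemma smulDr : right_distributive smul sadd.
Proof.
move=> f g h; apply: seriesP=> n; rewrite /= -big_split /=.
by apply: eq_bigr => i _; rewrite rmorphD mulrDr.
Qed.

HB.instance Definition _ := GRing.isPzRing.Build series
  saddA saddC sadd0 saddN smulA smul1 smulr1 smulDl smulDr.

Lemma scoefM f g n :
  (f * g) n = \sum_(i < n.+1) f i * twist i (g (n - i)%N).
Proof. by []. Qed.
Lemma scoefD f g n : (f + g) n = f n + g n. Proof. by []. Qed.
Lemma scoef1 n : (1 : series) n = if n is 0 then 1 else 0. Proof. by []. Qed.

Lemma scoefMz f n : (f * sz) n = if n is m.+1 then f m else 0.
Proof.
rewrite scoefM; case: n => [|n].
  by rewrite big_ord_recl big_ord0 /= mulr0 addr0.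
rewrite !big_ord_recr /= subnn subSnn /sz /= !raddf0 mulr0 addr0.
rewrite rmorph1 mulr1 big1 ?add0r // => i _.
by rewrite gtn_eqF ?raddf0 ?mulr0 // ltn_subRL addn1 ltnS.
Qed.

Lemma scoefzM f n : (sz * f) n = if n is m.+1 then autV rho (f m) else 0.
Proof.
rewrite scoefM big_ord_recl /= mul0r add0r; case: n => [|n].
  by rewrite big_ord0.
rewrite big_ord_recl /= /bump /= mul1r subn1 big1 ?addr0 // => i _.
by rewrite mul0r.
Qed.

Lemma sconst_morphism : GRing.monoid_morphism sconst.
Proof.
split=> // a b; apply: seriesP=> n; rewrite scoefM big_ord_recl /= subn0.
rewrite big1 ?addr0; first by case: n => [|n] //=; rewrite mulr0.
by move=> i _; rewrite mul0r.
Qed.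

Lemma sconstz a : sconst a * sz = sz * sconst (aut rho a).
Proof.
apply: seriesP=> n; rewrite scoefMz scoefzM; case: n => [|[|n]] //=.
  by rewrite autK.
by rewrite raddf0.
Qed.

Lemma sconstV a b : a * b = 1 -> sconst a * sconst b = 1.
Proof. by case: sconst_morphism => _ hM ab; rewrite -hM ab. Qed.

Definition sconst_unit (u : unitGroup A) : unitGroup series :=
  mk_unit (sconstV (val_unitV u)) (sconstV (val_unitVl u)).

Lemma scoef0M f g : (f * g) 0%N = f 0%N * g 0%N.
Proof. by rewrite scoefM big_ord_recl big_ord0 addr0. Qed.

Fixpoint sinv_list f n : seq A :=
  if n is m.+1 then
    let s := sinv_list f m in
    rcons s (- \sum_(i < m.+1) s`_i * twist i (f (m.+1 - i)%N))
  else [:: 1].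

Lemma left_inverse1 f : f 0%N = 1 -> exists2 g : series, g 0%N = 1 & g * f = 1.
Proof.
move=> f0; exists (TSeries rho (fun n => (sinv_list f n)`_n)) => //.
have sz_s m : size (sinv_list f m) = m.+1.
  by elim: m => //= m IH; rewrite size_rcons IH.
have nth_s i m : (i <= m)%N -> (sinv_list f m)`_i = (sinv_list f i)`_i.
  move=> /subnKC <-; elim: (m - i)%N => [|k IH]; first by rewrite addn0.
  by rewrite addnS /= nth_rcons sz_s ltnS leq_addr.
apply: seriesP=> -[|n]; first by rewrite scoef0M f0 mulr1.
rewrite scoefM big_ord_recr /= subnn f0 !rmorph1 mulr1 nth_rcons sz_s ltnn eqxx.
apply/eqP; rewrite subr_eq0; apply/eqP/eq_bigr => i _.
by rewrite (nth_s _ _ (leq_ord i)).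
Qed.

Lemma invertible1 f : f 0%N = 1 -> invertible f.
Proof.
move=> f0; have [g g0 gf] := left_inverse1 f0.
have [h _ hg] := left_inverse1 g0; apply: (mk_invertible (y := g)) => //.
by have -> : f = h by rewrite -[LHS]mul1r -hg -mulrA gf mulr1.
Qed.

Definition witt : {pred unitGroup series} := fun u =>
  `[< exists f : series, val u = 1 + sz * f >].

Lemma wittP (u : unitGroup series) :
  reflect ((val u : series) 0%N = 1) (u \in witt).
Proof.
apply: (iffP (asboolP _)) => [[f ->]|u0].
  by rewrite scoefD scoefzM scoef1 addr0.
exists (TSeries rho (fun n => aut rho ((val u : series) n.+1))).
apply: seriesP => n.
rewrite scoefD scoefzM scoef1; case: n => [|n]; first by rewrite u0 addr0.
by rewrite autK add0r.
Qed.

Lemma witt_closed : group_closed witt.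
Proof.
split=> [|u v /wittP u0 /wittP v0]; first by apply/wittP.
apply/wittP; rewrite val_unitM scoef0M u0 mul1r.
have := scoef0M (val v) (val v^-1%g); rewrite val_unitV v0 mul1r.
by move=> <-.
Qed.

Record wittGroup := WittGroup {
  witt_val : unitGroup series;
  _ : witt_val \in witt
}.

HB.instance Definition _ := [isSub for witt_val].
HB.instance Definition _ := [Choice of wittGroup by <:].
HB.instance Definition _ := SubChoice_isSubGroup.Build
  (unitGroup series) witt wittGroup witt_closed.

Definition witt_torsion (w : wittGroup) : K1 series := torsion (val w).

Lemma witt_torsion_morphism : monoid.monoid_morphism witt_torsion.
Proof. by split=> [|u v]; rewrite /witt_torsion ?gmulf1 // valM gmulfM. Qed.
HB.instance Definition _ := isUMagmaMorphism.Build wittGroup (K1 series)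
  witt_torsion witt_torsion_morphism.

Lemma one_plus_bz_invertible b : invertible (1 + sconst b * sz).
Proof. by apply: invertible1; rewrite scoefD scoefMz addr0. Qed.

Definition one_plus_bz b : unitGroup series := Sub _ (one_plus_bz_invertible b).

Definition witt1 : {pred K1 series} := fun x =>
  `[< exists w : wittGroup, x = witt_torsion w >].

Lemma witt1_closed : group_closed witt1.
Proof.
split=> [|_ _ /asboolP[u ->] /asboolP[v ->]]; apply/asboolP.
  by exists 1%g; rewrite gmulf1.
by exists (u / v)%g; rewrite gmulfF.
Qed.

Record witt1Group := Witt1Group {
  witt1_val : K1 series;
  _ : witt1_val \in witt1
}.

HB.instance Definition _ := [isSub for witt1_val].
HB.instance Definition _ := [Choice of witt1Group by <:].
HB.instance Definition _ := SubChoice_isSubGroup.Build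
  (K1 series) witt1 witt1Group witt1_closed.

Lemma witt_torsion_in (w : wittGroup) : witt_torsion w \in witt1.
Proof. by apply/asboolP; exists w. Qed.

(* J is induced by w |-> torsion w: J_class shows that the representative
   chosen by repr is irrelevant. *)
Definition J (x : ab wittGroup) : witt1Group :=
  Witt1Group (witt_torsion_in (repr x)).

Lemma witt_torsion_comm (w : wittGroup) :
  w \in commSubgroup wittGroup -> witt_torsion w = 1%g.
Proof.
move/commSubgroupP => /(_ (fun w => witt_torsion w == 1%g)) h; apply/eqP/h.
  split=> [|u v]; rewrite !unfold_in ?gmulf1 // => /eqP tu /eqP tv.
  by rewrite gmulfF /= tu tv divg1.
move=> u v; rewrite unfold_in gmulfR -[_ == _]/(_ == 1%g).
exact/commgP/ab_mulC.
Qed.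

Lemma J_class (w : wittGroup) : val (J (ab_class w)) = witt_torsion w.
Proof.
have /ab_classP/witt_torsion_comm := ab_class_repr (ab_class w).
by rewrite gmulfM gmulfV => /eqP; rewrite mulg_eq1 => /eqP/invg_inj.
Qed.

Lemma J_surj (y : witt1Group) : exists x, J x = y.
Proof.
case: y => y hy; case/asboolP: (hy) => w ew; exists (ab_class w).
by apply: val_inj; rewrite J_class.
Qed.

Lemma J_morphism : monoid.monoid_morphism J.
Proof.
split; first by apply: val_inj; rewrite J_class gmulf1.
elim/ab_ind=> x; elim/ab_ind=> y; apply: val_inj.
by rewrite valM -gmulfM !J_class gmulfM.
Qed.
HB.instance Definition _ :=
  isUMagmaMorphism.Build (ab wittGroup) witt1Group J J_morphism.

End TwistedSeries.
Arguments witt {A} rho _.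
Arguments witt1 {A} rho _.

(* Main.v *)
Require Import Defs.
From mathcomp Require Import all_boot all_order all_algebra.

Import GRing.Theory.
Local Open Scope ring_scope.

(** For [rho = id] the variable [z] is central, so the coefficient of [z] in a
product [(1 + a z + ..) (1 + b z + ..)] is [a + b]: taking the linear
coefficient is a homomorphism from the Witt vectors to the additive group of
[A].  Its target is abelian, hence it kills every commutator of Witt vectors
([witt_comm_coef1]).  On [y = alpha (1 + beta z) alpha^-1 (1 + beta z)^-1] it
takes the value [alpha beta alpha^-1 - beta], which is nonzero, so [y] is not
in the commutator subgroup of the Witt vectors.

On the other hand [y] is a commutator in the larger group of all units of the
power series ring, because the constant series [alpha] lives there; the
Whitehead group being abelian, the torsion of [y] vanishes ([torsion_comm]).
Thus the class of [y] is a nontrivial element of the kernel of [J].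

Such [alpha] and [beta] exist in the ring of 2 by 2 integer matrices: a
transvection does not commute with a diagonal idempotent
([transvection_conj_neq]). *)

Section LinearCoefficient.
Variable A : pzRingType.
Local Notation series := (tseries (idAut A)).
Local Notation W := (wittGroup (idAut A)).

Lemma scoef1M (f g : series) : (f * g) 1%N = f 0%N * g 1%N + f 1%N * g 0%N.
Proof. by rewrite scoefM !big_ord_recl big_ord0 addr0. Qed.

Definition witt_coef1 (w : W) : A := (val (val w) : series) 1%N.

Lemma witt_coef1M (u v : W) :
  witt_coef1 (u * v)%g = witt_coef1 u + witt_coef1 v.
Proof.
have /wittP u0 := valP u; have /wittP v0 := valP v.
by rewrite /witt_coef1 valM val_unitM scoef1M u0 v0 mul1r mulr1 addrC.
Qed.

Lemma witt_coef1_div (u v : W) :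
  witt_coef1 (u / v)%g = witt_coef1 u - witt_coef1 v.
Proof.
by apply: (addIr (witt_coef1 v)); rewrite -witt_coef1M mulgVK subrK.
Qed.

(** The kernel of [witt_coef1] is a subgroup containing all commutators,
since the target [(A, +)] is abelian. *)
Lemma witt_comm_coef1 (w : W) : w \in commSubgroup W -> witt_coef1 w = 0.
Proof.
move/commSubgroupP => /(_ (fun w => witt_coef1 w == 0)) h; apply/eqP/h.
  split=> [|u v]; first by rewrite unfold_in.
  by rewrite !unfold_in witt_coef1_div => /eqP-> /eqP->; rewrite subr0.
move=> u v; rewrite unfold_in.
apply/eqP; apply: (addrI (witt_coef1 (v * u)%g)).
rewrite -witt_coef1M commgEl -mulgA mulVKg mulVKg addr0.
by rewrite !witt_coef1M addrC.
Qed.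

End LinearCoefficient.

Lemma torsion_comm (R : pzRingType) (u v : unitGroup R) :
  torsion [~ u, v]%g = 1%g.
Proof. by rewrite gmulfR; apply/eqP/commgP/ab_mulC. Qed.

Section ConjugateQuotient.
Variables (A : pzRingType) (alpha : unitGroup A) (beta : A).
Local Notation rho := (idAut A).
Local Notation series := (tseries rho).

Let y : unitGroup series :=
  (sconst_unit rho alpha * one_plus_bz rho beta *
   sconst_unit rho alpha^-1 * (one_plus_bz rho beta)^-1)%g.

(** Clearing the denominator [1 + beta z] avoids computing its inverse. *)
Let y_mul : val y * val (one_plus_bz rho beta) =
  sconst rho (val alpha) * val (one_plus_bz rho beta)
    * sconst rho (val alpha^-1%g).
Proof. by rewrite -val_unitM /y mulgVK. Qed.

Let b0 : (val (one_plus_bz rho beta) : series) 0%N = 1.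
Proof. by rewrite scoefD scoefMz addr0. Qed.

Let b1 : (val (one_plus_bz rho beta) : series) 1%N = beta.
Proof. by rewrite scoefD scoefMz add0r. Qed.

Let y0 : (val y : series) 0%N = 1.
Proof.
have := congr1 (fun f : series => f 0%N) y_mul.
by rewrite !scoef0M b0 !mulr1 [sconst _ _ _]/= val_unitV.
Qed.

Lemma conj_quotient_witt : y \in witt rho.
Proof. exact/wittP/y0. Qed.

Lemma conj_quotient_coef1 :
  (val y : series) 1%N = val alpha * beta * val alpha^-1%g - beta.
Proof.
(* [val y] unfolds to a product; generalizing it keeps [scoef1M] from
   expanding it. *)
move: y_mul y0; move: (val y : series) => f /(congr1 (fun g : series => g 1%N)).
have c0 a : sconst rho a 0%N = a by [].
have c1 a : sconst rho a 1%N = 0 by [].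
rewrite !scoef1M scoef0M b0 b1 !c0 !c1 mulr0 mul0r mulr1 addr0 add0r.
by move=> <- ->; rewrite mul1r addrAC subrr add0r.
Qed.

(** [y] is the commutator of the inverses of the units [alpha] and
[1 + beta z]; the first is a Witt vector only when [alpha = 1]. *)
Lemma conj_quotient_torsion : torsion y = 1%g.
Proof.
suff -> : y = [~ (sconst_unit rho alpha)^-1, (one_plus_bz rho beta)^-1]%g.
  exact: torsion_comm.
have aV : sconst_unit rho alpha^-1%g = ((sconst_unit rho alpha)^-1)%g.
  apply: (mulgI (sconst_unit rho alpha)); rewrite mulgV.
  by apply: val_inj; rewrite val_unitM; exact: sconstV (val_unitV alpha).
by rewrite /y aV /commg /conjg !invgK !mulgA.
Qed.

End ConjugateQuotient.

Lemma J_not_bijective (A : pzRingType) (rho : ringAut A) (w : wittGroup rho) :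
  w \notin commSubgroup (wittGroup rho) -> J (ab_class w) = 1%g ->
  ~ bijective (@J A rho).
Proof.
move=> /negP wN Jw /bij_inj Jinj; apply: wN.
have /Jinj/ab_classP : J (ab_class (1%g : wittGroup rho)) = J (ab_class w).
  by rewrite Jw !gmulf1.
by rewrite invg1 mul1g.
Qed.

Section NoncommutingMatrices.
Local Notation M := 'M[int]_2.
Let e00 : M := delta_mx 0 0.
Let e01 : M := delta_mx 0 1.

Let e01_sq : e01 * e01 = 0.
Proof. exact: mul_delta_mx_0. Qed.

Let transvectionV : (1 + e01) * (1 - e01) = 1.
Proof. by rewrite mulrBr mulr1 mulrDl mul1r e01_sq addr0 addrK. Qed.

Let transvectionVl : (1 - e01) * (1 + e01) = 1.
Proof. by rewrite mulrDr mulr1 mulrBl mul1r e01_sq subr0 subrK. Qed.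

Definition transvection : unitGroup M := mk_unit transvectionV transvectionVl.

Lemma transvection_conj_neq :
  unit_val transvection * e00 * unit_val transvection^-1%g <> e00.
Proof.
move=> /(congr1 (fun m => m * unit_val transvection)).
rewrite -mulrA (val_unitVl transvection) mulr1 /= mulrDl mulrDr mul1r mulr1.
have -> : e01 * e00 = 0 by exact: mul_delta_mx_0.
have -> : e00 * e01 = e01 by exact: mul_delta_mx.
by move/addrI/matrixP => /(_ 0 1); rewrite !mxE.
Qed.

End NoncommutingMatrices.

Theorem mainTheorem3 :
  (forall (A : pzRingType) (alpha : unitGroup A) (beta : A),
     unit_val alpha * beta * unit_val (alpha^-1)%g <> beta ->
     let rho := idAut A in
     let y : unitGroup (tseries rho) :=
       (sconst_unit rho alpha * one_plus_bz rho beta *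
        sconst_unit rho alpha^-1 * (one_plus_bz rho beta)^-1)%g in
     exists Wy : y \in witt rho,
       [/\ WittGroup Wy \notin commSubgroup (wittGroup rho),
           J (ab_class (WittGroup Wy)) = 1%g
         & ~ bijective (@J A rho)]) /\
  exists A : pzRingType, ~ bijective (@J A (idAut A)).
Proof.
have main (A : pzRingType) (alpha : unitGroup A) (beta : A) :
    unit_val alpha * beta * unit_val (alpha^-1)%g <> beta ->
    let w := WittGroup (conj_quotient_witt A alpha beta) in
    w \notin commSubgroup (wittGroup (idAut A)) /\ J (ab_class w) = 1%g.
  move=> ab_neq w; split.
    apply/negP => /witt_comm_coef1; rewrite /witt_coef1 conj_quotient_coef1.
    by move/eqP; rewrite subr_eq0 => /eqP.
  by apply: val_inj; rewrite J_class; exact: conj_quotient_torsion.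
split=> [A alpha beta /main[wN Jw] rho y|].
  exists (conj_quotient_witt A alpha beta).
  by split; [| | exact: J_not_bijective _ _ _ wN Jw].
exists 'M[int]_2; have [wN Jw] := main _ _ _ transvection_conj_neq.
exact: J_not_bijective _ _ _ wN Jw.
Qed.
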